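(* Let $\mathcal{V}$ be a set with $|\mathcal{V}|=n$ and suppose all maps $\phi:\mathcal{V}\to\mathcal{V}$ are assigned equal probability $n^{-n}$. Let $\Gamma=\Gamma(\phi)$ be the random functional graph with node set $\mathcal{V}$ and arcs $(v\to\phi(v))$, $v\in\mathcal{V}$. Then the expectation of $f_\Gamma$, as a function of $n$, satisfies $$\mathbb{E} f_\Gamma\sim\sqrt{\pi n/2}\qquad (n\to\infty).$$
   Context: For a finite directed graph $\Gamma$ (loops allowed) with arc set $\mathcal{A}(\Gamma)$, $f_\Gamma=\min \sum_{a\in\mathcal{A}(\Gamma)} x_a$, the minimum being over all vectors $(x_a)_{a\in\mathcal{A}(\Gamma)}$ with $x_a\ge 0$ such that $\prod_{a\in\gamma}x_a=1$ for every directed cycle $\gamma$ of $\Gamma$ (a closed directed path not passing through the same node twice; loops are cycles of length one). *)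

(* Defs.v *)
From HB Require Import structures.
From mathcomp Require Import all_boot all_order all_algebra.
From mathcomp Require Import all_classical all_reals all_analysis.

Set Implicit Arguments.
Unset Strict Implicit.
Unset Printing Implicit Defensive.

Import Order.TTheory GRing.Theory Num.Theory.
Import numFieldNormedType.Exports.

Local Open Scope classical_set_scope.
Local Open Scope ring_scope.

Section Digraph.
Variables (R : realType) (V : finType) (e : rel V).

(* A directed graph on V is a relation e : rel V, with an arc (u, v) whenever
   e u v.  A weight vector is a function on V * V; only its values on arcs are
   ever used.  A directed cycle is a nonempty duplicate-free sequence c of
   nodes that is an e-cycle, and its arcs are the pairs (v, next c v) for v in
   c; for c = [:: v] this is the loop (v, v). *)
Definition admissible (x : V * V -> R) : Prop :=
  (forall a, e a.1 a.2 -> 0 <= x a) /\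
  (forall c : seq V, c != [::] -> ucycle e c ->
     \prod_(v <- c) x (v, next c v) = 1).

Definition arc_sums : set R :=
  [set s | exists2 x, admissible x & s = \sum_(a : V * V | e a.1 a.2) x a].

(* The least element of arc_sums; it exists by a compactness argument, so that
   the default value 0 of xget plays no role. *)
Definition graph_min : R := xget 0 (arc_sums `&` lbound arc_sums).

End Digraph.

(* frel phi is the relation u -> v iff v = phi u; every map phi has
   probability #|V| ^- #|V|. *)
Definition expected_graph_min (R : realType) (V : finType) : R :=
  \sum_(phi : {ffun V -> V}) #|V|%:R ^- #|V| * graph_min R (frel phi).

(* Main.v *)
(* On a functional graph the cycles are disjoint, so AM-GM over the cyclic nodes
   shows that the minimum is the number of cyclic nodes, attained by giving
   weight 1 to the arcs on cycles and 0 to the others.  A uniq k-tuple is a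
   cycle of n ^ (n - k) of the n ^ n maps, so the expected number of cyclic nodes is
   sum_(1 <= k <= n) n (n - 1) ... (n - k + 1) / n ^ k, and the k-th summand is
   prod_(j < k) (1 - j / n).  The inequalities 1 - t <= exp (- t) and
   1 - t >= exp (- t / (1 - eps)) for t <= eps compare the sum with Riemann
   sums of the Gauss function of step of order n ^ (-1/2). *)
Require Import Defs.
From mathcomp Require Import all_boot all_order all_algebra.
From mathcomp Require Import all_classical all_reals all_analysis.
From mathcomp Require Import ring lra.
Import Order.TTheory GRing.Theory Num.Theory.
Import numFieldNormedType.Exports.
Local Open Scope classical_set_scope.
Local Open Scope ring_scope.

Set Implicit Arguments.
Unset Strict Implicit.

(** * Cyclic nodes and the minimum on a functional graph *)

Definition cyclic_node (V : finType) (phi : V -> V) : pred V :=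
  fun v => fcycle phi (orbit phi v).

Lemma fcycle_cyclic_node (V : finType) (phi : V -> V) (c : seq V) (v : V) :
  fcycle phi c -> v \in c -> cyclic_node phi v.
Proof. by move=> cc vc; exact: (cycle_orbit_cycle cc). Qed.

Lemma orbit_cyclic_node (V : finType) (phi : V -> V) (u v : V) :
  cyclic_node phi v -> u \in orbit phi v ->
  cyclic_node phi u /\ orbit phi u =i orbit phi v.
Proof.
move=> cv uv; split; first exact: fcycle_cyclic_node cv uv.
by move=> w; rewrite -fconnect_orbit (fconnect_cycle cv uv).
Qed.

(** The cyclic nodes split into disjoint cycles, and admissibility makes the product over each cycle
    equal to 1. *)
Lemma prod_cyclic_node (R : realType) (V : finType) (phi : V -> V)
    (x : V * V -> R) :
  admissible (frel phi) x ->
  \prod_(v in cyclic_node phi) x (v, phi v) = 1.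
Proof.
move=> [_ xcycle].
(* The orbit taken as a set labels a cycle independently of its starting node. A set [S] that is not
   the orbit of a cyclic node contributes an empty product. *)
rewrite (partition_big (fun v => [set u in orbit phi v]%SET) predT)//=.
apply: big1 => S _.
have [v /andP[cv /eqP vS]|noS] := pickP (fun v =>
  (v \in cyclic_node phi) && ([set u in orbit phi v]%SET == S));
  last by rewrite big_pred0.
have := xcycle (orbit phi v); rewrite /ucycle orbit_uniq.
have -> : orbit phi v != [::] by rewrite -size_eq0 size_orbit -lt0n order_gt0.
move=> /(_ isT); rewrite [cycle _ _]cv => /(_ isT) prod1.
rewrite -[RHS]prod1 [RHS]big_uniq ?orbit_uniq//=; apply: eq_big => [u|u /andP[cu /eqP uS]].
  apply/andP/idP => [[cu /eqP uS]|uv].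
    have : u \in [set w in orbit phi u]%SET by rewrite inE in_orbit.
    by rewrite uS -vS inE.
  have [cu uvE] := orbit_cyclic_node cv uv; split => //.
  by rewrite -vS; apply/eqP/setP => w; rewrite !inE uvE.
rewrite (nextE cv)//.
have : u \in [set w in orbit phi u]%SET by rewrite inE in_orbit.
by rewrite uS -vS inE.
Qed.

Lemma sum_frel (R : realType) (V : finType) (phi : V -> V) (x : V * V -> R) :
  \sum_(a : V * V | frel phi a.1 a.2) x a = \sum_v x (v, phi v).
Proof.
transitivity (\sum_u \sum_(v | phi u == v) x (u, v)).
  by rewrite pair_big_dep/=; apply: eq_big => [[u v]|[u v]].
by apply: eq_bigr => u _; rewrite (big_pred1 (phi u))// => v; rewrite eq_sym.
Qed.

Lemma graph_min_frel (R : realType) (V : finType) (phi : V -> V) :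
  graph_min R (frel phi) = #|cyclic_node phi|%:R.
Proof.
set A := cyclic_node phi.
have A_arc_sum : arc_sums (frel phi) (#|A|%:R : R).
  exists (fun a => (a.1 \in A)%:R); last first.
    rewrite sum_frel/= -natr_sum -sum1_card; congr (_%:R).
    by rewrite [LHS]big_mkcond/=; apply: eq_bigr => v _; case: (v \in A).
  split=> [a _|c _ /andP[cc _]]; first by rewrite ler0n.
  rewrite big_seq big1// => v vc /=.
  by rewrite [v \in A](fcycle_cyclic_node cc vc).
have lb : lbound (arc_sums (frel phi)) (#|A|%:R : R).
  move=> _ [x xadm ->]; rewrite sum_frel.
  have x0 v : 0 <= x (v, phi v) by apply: (proj1 xadm) => /=.
  rewrite (bigID (mem A))/= -[leLHS]addr0 lerD ?sumr_ge0//.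
  (* The arithmetic mean over [A] divides by [#|A|], so the empty case is set apart. *)
  have [->|A0] := posnP #|A|; first by rewrite sumr_ge0.
  have /leifP := @leif_AGM _ _ A (fun v => x (v, phi v)) (fun v _ => x0 v).
  rewrite prod_cyclic_node// => H.
  have {H} : 1 <= ((\sum_(i in A) x (i, phi i)) / #|A|%:R) ^+ #|A|.
    by move: H; case: ifP => _ => [/eqP <-//|/ltW].
  by rewrite expr_ge1 ?divr_ge0 ?sumr_ge0// ler_pdivlMr ?ltr0n// mul1r.
(* The default branch of [xget] is excluded because [#|A|] is itself a least element; in the other
   branch, two least elements coincide. *)
rewrite /graph_min; case: xgetP => [s _ [sm slb]|/(_ #|A|%:R)[]//].
by apply/eqP; rewrite eq_le lb// slb.
Qed.

(** * Counting cyclic nodes over all maps *)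

Lemma card_cyclic_node_order (V : finType) (phi : V -> V) (k : nat) :
  #|[set v | cyclic_node phi v && (order phi v == k.+1)]%SET| =
  #|[set t : k.+1.-tuple V | uniq t && fcycle phi t]%SET|.
Proof.
(* A cycle of [phi] is determined by its head and its length, so [thead] is injective on cycles; the
   inverse is [orbit]. *)
rewrite -(@card_in_imset _ _ (@thead k V) _ _); last first.
  move=> s t; rewrite !inE => /andP[_ cs] /andP[_ ct] st.
  apply: val_inj => /=; move: cs ct.
  case/tupleP: s st => x s; case/tupleP: t => y t; rewrite !theadE => <-.
  move=> /= cs ct.
  by rewrite (fcycle_consE cs) (fcycle_consE ct) !size_tuple.
congr #|pred_of_set _|; apply/setP => v; rewrite !inE.
apply/andP/imsetP => [[cv /eqP vk]|[t]].
  have st : size (orbit phi v) == k.+1 by rewrite size_orbit vk.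
  exists (Tuple st); first by rewrite inE /= orbit_uniq.
  rewrite (tuple_eta (Tuple st)) theadE /thead (tnth_nth v) /= /orbit vk //.
rewrite inE => /andP[ut ct ->].
have tt : thead t \in (t : seq V) by rewrite mem_tnth.
by rewrite (fcycle_cyclic_node ct tt) (order_cycle ct ut tt) size_tuple.
Qed.

(** The cyclic nodes are sorted by period [k.+1]. Cycles are tuples with a starting point, so one of
    length [k.+1] is counted once for each of its nodes. *)
Lemma card_cyclic_node (V : finType) (phi : V -> V) :
  #|cyclic_node phi| =
  (\sum_(k < #|V|) #|[set t : k.+1.-tuple V | uniq t && fcycle phi t]%SET|)%N.
Proof.
rewrite -sum1_card.
have ho (v : V) : ((order phi v).-1 < #|V|)%N.
  by rewrite orderSpred max_card.
rewrite (partition_big (fun v => Ordinal (ho v)) predT)//=.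
apply: eq_bigr => k _; rewrite -card_cyclic_node_order -[RHS]sum1_card.
apply: eq_bigl => v; rewrite !inE -[v \in cyclic_node phi]/(cyclic_node phi v).
by rewrite -val_eqE/= -(orderSpred phi v) eqSS.
Qed.

(** Having [t] as a cycle prescribes [phi] at the nodes of [t] and leaves all other values free. *)
Lemma card_fcycle_ffun (V : finType) (t : seq V) : uniq t ->
  #|[set phi : {ffun V -> V} | fcycle phi t]%SET| = (#|V| ^ (#|V| - size t))%N.
Proof.
move=> ut.
pose F (v : V) : pred V := if v \in t then pred1 (next t v) else predT.
transitivity #|family F|.
  apply: eq_card => phi; rewrite inE; apply/idP/familyP => [ct v|Fphi].
    rewrite /F; case: ifPn => // vt.
    by rewrite (nextE ct vt) inE.
  apply: cycle_from_next => // v vt; have := Fphi v.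
  by rewrite /F vt inE.
rewrite card_family foldrE big_map big_enum/=.
rewrite (bigID (mem t))/= big1 ?mul1n; last first.
  by move=> v vt; rewrite /F vt card1.
rewrite (eq_bigr (fun=> #|V|)); last by move=> v /negbTE vt; rewrite /F vt.
rewrite prod_nat_const -(card_uniqP ut); congr (_ ^ _)%N.
by rewrite -(cardC (mem t)) addKn; apply: eq_card.
Qed.

(** Double counting of the pairs of a map and one of its cycles: the sum over maps is moved inside
    the sum over duplicate-free tuples. *)
Lemma sum_card_cyclic_node (V : finType) :
  (\sum_(phi : {ffun V -> V}) #|cyclic_node phi| =
   \sum_(k < #|V|) #|V| ^_ k.+1 * #|V| ^ (#|V| - k.+1))%N.
Proof.
under eq_bigr do rewrite card_cyclic_node.
rewrite exchange_big/=; apply: eq_bigr => k _.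
under eq_bigr do rewrite -sum1dep_card big_mkcondr/=.
rewrite exchange_big/=.
rewrite (eq_bigr (fun=> #|V| ^ (#|V| - k.+1)))%N; last first.
  move=> t ut; rewrite -big_mkcond/= sum1dep_card card_fcycle_ffun//.
  by rewrite size_tuple.
rewrite sum_nat_const; congr (_ * _)%N.
apply: etrans (card_uniq_tuples k.+1 (@predT V)).
by apply: eq_card => t; rewrite !inE all_predT.
Qed.

Lemma expected_graph_minE (R : realType) (V : finType) :
  expected_graph_min R V =
  \sum_(k < #|V|) (#|V| ^_ k.+1)%:R / #|V|%:R ^+ k.+1.
Proof.
rewrite /expected_graph_min.
under eq_bigr do rewrite graph_min_frel.
rewrite -mulr_sumr -natr_sum sum_card_cyclic_node natr_sum mulr_sumr.
apply: eq_bigr => k _.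
have V0 : #|V|%:R != 0 :> R by rewrite pnatr_eq0 -lt0n (leq_ltn_trans _ (ltn_ord k)).
rewrite natrM natrX mulrCA; congr (_ * _).
have -> : #|V|%:R ^+ #|V| = #|V|%:R ^+ (#|V| - k.+1) * #|V|%:R ^+ k.+1 :> R.
  by rewrite -exprD subnK.
by rewrite invfM mulrAC mulVf ?mul1r ?expf_neq0.
Qed.

(** * Riemann sums of the Gauss function *)

Section GaussSums.
Import gauss_integral_proof.
Context {R : realType}.
Implicit Types a b c : R.

Lemma integral0_gauss_increment a b : 0 <= a -> a <= b ->
  exists2 c, a <= c <= b &
    integral0_gauss b - integral0_gauss a = gauss_fun c * (b - a).
Proof.
move=> a0 ab.
have [|x /andP[ax xb]||c cab ->] := @MVT_segment R integral0_gauss gauss_fun a b.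
- by [].
- have x0 : 0 < x by rewrite (le_lt_trans a0).
  (* The endpoint [x + 1] only serves to make [x] interior to the interval of integration. *)
  have [] := @continuous_FTC1 R gauss_fun (BLeft 0) x (x + 1).
  + by rewrite ltrDl.
  + apply: continuous_compact_integrable; first exact: segment_compact.
    by apply: continuous_subspaceT; exact: continuous_gauss_fun.
  + by rewrite /= lte_fin.
  + exact: continuous_gauss_fun.
  by move=> dF <-; apply: DeriveDef; rewrite ?derive1E.
- apply: (@continuous_subspaceW _ _ _ `[0, b]).
    by apply: subset_itvr; rewrite bnd_simp.
  apply: parameterized_integral_continuous; first exact: le_trans ab.
  apply: continuous_compact_integrable; first exact: segment_compact.
  by apply: continuous_subspaceT; exact: continuous_gauss_fun.
by exists c.
Qed.

Lemma gauss_fun_nonincreasing a b : 0 <= a -> a <= b -> gauss_fun b <= gauss_fun a.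
Proof.
move=> a0 ab; rewrite ler_expR lerN2 ler_sqr//.
by rewrite nnegrE (le_trans a0).
Qed.

Lemma integral0_gauss_nondecreasing a b : 0 <= a -> a <= b ->
  integral0_gauss a <= integral0_gauss b.
Proof.
move=> a0 ab; have [c _ E] := integral0_gauss_increment a0 ab.
by rewrite -subr_ge0 E mulr_ge0 ?gauss_fun_ge0// subr_ge0.
Qed.

Lemma integral0_gauss0 : integral0_gauss 0 = 0 :> R.
Proof. by rewrite /integral0_gauss set_itv1 Rintegral_set1. Qed.

Lemma integral0_gauss_le_id a : 0 <= a -> integral0_gauss a <= a.
Proof.
move=> a0; have [c _] := integral0_gauss_increment (lexx 0) a0.
rewrite integral0_gauss0 !subr0 => ->.
by rewrite ler_piMl// gauss_fun_le1.
Qed.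

Lemma half_sqrt_pi : Num.sqrt pi / 2 = Num.sqrt (pi / 4) :> R.
Proof.
rewrite sqrtrM ?pi_ge0// sqrtrV// (_ : 4 = 2 ^+ 2); last by ring.
by rewrite sqrtr_sqr ger0_norm.
Qed.

(** The square of this nonnegative function is known to tend to [pi / 4], and the square root is
    continuous. *)
Lemma cvg_integral0_gauss :
  (integral0_gauss x : R) @[x --> +oo] --> Num.sqrt pi / 2.
Proof.
have -> : integral0_gauss = (fun x : R => Num.sqrt (integral0_gauss x ^+ 2)).
  by apply/funext => x; rewrite sqrtr_sqr ger0_norm// integral0_gauss_ge0.
rewrite half_sqrt_pi.
by apply: continuous_cvg; [exact: sqrt_continuous|exact: cvg_integral0_gauss_sqr].
Qed.

Lemma integral0_gauss_le a : integral0_gauss a <= Num.sqrt pi / 2.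
Proof.
have [a0|a0] := leP 0 a; last first.
  (* For negative [a] the interval of integration is empty and the integral is 0. *)
  rewrite /integral0_gauss set_itv_ge -?leNgt ?bnd_simp -?ltNge//.
  by rewrite Rintegral_set0 divr_ge0.
rewrite -(cvg_lim _ cvg_integral0_gauss)//.
apply: limr_ge; first by apply/cvg_ex; eexists; exact: cvg_integral0_gauss.
apply: filterS (nbhs_pinfty_ge (num_real a)) => b.
exact: integral0_gauss_nondecreasing.
Qed.

(** By monotonicity each term times [c] is at most the integral over the step to its left. The term
    at 0 has no such step and accounts for the 1. *)
Lemma sum_gauss_fun_le c n : 0 < c ->
  \sum_(i < n) gauss_fun (i%:R * c) <= 1 + integral0_gauss (n%:R * c) / c.
Proof.
move=> c0; case: n => [|n].
  by rewrite big_ord0 addr_ge0 ?divr_ge0 ?integral0_gauss_ge0// ltW.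
rewrite big_ord_recl lerD ?gauss_fun_le1//.
rewrite ler_pdivlMr//.
apply: (@le_trans _ _ (integral0_gauss (n%:R * c))); last first.
  apply: integral0_gauss_nondecreasing; first by rewrite mulr_ge0// ltW.
  by rewrite ler_pM2r// ler_nat.
elim: n => [|n IH]; first by rewrite big_ord0 mul0r integral0_gauss_ge0.
rewrite big_ord_recr/= mulrDl -lerBrDl.
rewrite (le_trans _ (lerB (lexx _) IH))//.
have nc : n%:R * c <= n.+1%:R * c by rewrite ler_pM2r// ler_nat.
have nc0 : 0 <= n%:R * c by rewrite mulr_ge0// ltW.
have [d /andP[nd dn] ->] := integral0_gauss_increment nc0 nc.
have -> : n.+1%:R * c - n%:R * c = c by rewrite -natr1; ring.
by rewrite ler_pM2r// gauss_fun_nonincreasing// (le_trans nc0).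
Qed.

(** Each term times [c] is at least the integral over the step to its right. The steps reach
    [n.+1%:R * c] but miss the first one, whose integral is at most [c]; hence the [- 1]. *)
Lemma le_sum_gauss_fun c n : 0 < c ->
  integral0_gauss (n.+1%:R * c) / c - 1 <= \sum_(i < n) gauss_fun (i.+1%:R * c).
Proof.
move=> c0; rewrite lerBlDr ler_pdivrMr//.
elim: n => [|n IH].
  by rewrite big_ord0 add0r !mul1r integral0_gauss_le_id// ltW.
rewrite big_ord_recr/= [X in _ <= X * c]addrAC [leRHS]mulrDl -lerBlDl.
rewrite (le_trans (lerB (lexx _) IH))//.
have nc : n.+1%:R * c <= n.+2%:R * c by rewrite ler_pM2r// ler_nat.
have nc0 : 0 <= n.+1%:R * c by rewrite mulr_ge0// ltW.
have [d /andP[nd dn] ->] := integral0_gauss_increment nc0 nc.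
have -> : n.+2%:R * c - n.+1%:R * c = c by rewrite -[n.+2%:R]natr1; ring.
by rewrite ler_pM2r// gauss_fun_nonincreasing.
Qed.

End GaussSums.

(** * Asymptotics of the birthday sum *)

Section BirthdaySum.
Import gauss_integral_proof.
Context {R : realType}.
Implicit Types (n k : nat) (eps x : R).

(** For positive [n], this is the probability that [k] independent uniform draws from [n] values are
    pairwise distinct. *)
Definition birthday_prod n k : R := \prod_(j < k) (1 - j%:R / n%:R).

Lemma birthday_prodE n k : (k <= n)%N -> (0 < n)%N ->
  birthday_prod n k = (n ^_ k)%:R / n%:R ^+ k.
Proof.
move=> kn n0; elim: k kn => [_|k IH kn].
  by rewrite /birthday_prod big_ord0 invr1 mulr1.
rewrite /birthday_prod big_ord_recr/= -/(birthday_prod n k) IH 1?ltnW//.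
rewrite ffactnSr natrM natrB 1?ltnW//.
have nz : n%:R != 0 :> R by rewrite pnatr_eq0 -lt0n.
by rewrite exprS invfM; field; rewrite nz expf_neq0.
Qed.

Lemma birthday_prod_ge0 n k : (k <= n)%N -> 0 <= birthday_prod n k.
Proof.
move=> kn; apply: prodr_ge0 => j _.
have jn : (j < n)%N by rewrite (leq_trans (ltn_ord j)).
by rewrite subr_ge0 ler_pdivrMr ?mul1r ?ler_nat ?ltr0n ?(ltnW jn)// (leq_ltn_trans _ jn).
Qed.

Lemma gauss_fun_div_sqrt x y : 0 <= y ->
  gauss_fun (x * (Num.sqrt y)^-1) = expR (- (x ^+ 2 / y)).
Proof. by move=> y0; rewrite /gauss_fun exprMn exprVn sqr_sqrtr. Qed.

(** The exponents [j / n] add up to [k (k + 1) / (2 n)], in which [k + 1] is then lowered to [k] to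
    reach a Gauss function. *)
Lemma birthday_prod_le_gauss n k : (k < n)%N ->
  birthday_prod n k.+1 <= gauss_fun (k%:R * (Num.sqrt (2 * n%:R))^-1).
Proof.
move=> kn; have n0 : 0 < n%:R :> R by rewrite ltr0n (leq_ltn_trans _ kn).
suff H : birthday_prod n k.+1 <= expR (- (k%:R * k.+1%:R / (2 * n%:R))).
  rewrite gauss_fun_div_sqrt ?mulr_ge0//; apply: le_trans H _.
  rewrite ler_expR lerN2 ler_wpM2r ?invr_ge0 ?mulr_ge0//.
  by rewrite expr2 ler_wpM2l// ler_nat.
elim: k kn => [_|k IH kn].
  by rewrite /birthday_prod big_ord1 !mul0r subr0 oppr0 expR0.
rewrite /birthday_prod big_ord_recr/=.
have -> : - (k.+1%:R * k.+2%:R / (2 * n%:R)) =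
    - (k%:R * k.+1%:R / (2 * n%:R)) - k.+1%:R / n%:R :> R.
  by rewrite -[k.+2%:R]natr1 -[k.+1%:R]natr1; field; rewrite lt0r_neq0.
rewrite expRD ler_pM//; first by apply: birthday_prod_ge0; exact: ltnW.
- by rewrite subr_ge0 ler_pdivrMr// mul1r ler_nat ltnW.
- by apply: IH; exact: ltnW.
- exact: expR_ge1Dx.
Qed.

(* [1 - t >= exp (- t / (1 - t))] is [1 + s <= exp s] at [s = t / (1 - t)]. *)
Lemma expR_le_onem eps (t : R) : 0 <= t -> t <= eps -> eps < 1 ->
  expR (- (t / (1 - eps))) <= 1 - t.
Proof.
move=> t0 te e1.
have t1 : 0 < 1 - t by rewrite subr_gt0 (le_lt_trans te).
apply: (@le_trans _ _ (expR (- (t / (1 - t))))).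
  rewrite ler_expR lerN2 ler_wpM2l// lef_pV2 ?posrE ?t1 ?subr_gt0//.
  by rewrite lerB.
rewrite expRN -[leRHS]invrK lef_pV2 ?posrE ?expR_gt0 ?invr_gt0//.
rewrite [leLHS](_ : _ = 1 + t / (1 - t)); last by field; rewrite lt0r_neq0.
exact: expR_ge1Dx.
Qed.

(** The bound on [k.+1] keeps every ratio [j / n] below [eps], so [expR_le_onem] applies to each
    factor. Here [k (k + 1)] is raised to the square of [k + 1]. *)
Lemma gauss_le_birthday_prod eps n k :
  0 < eps -> eps < 1 -> (0 < n)%N -> k.+1%:R <= eps * n%:R ->
  gauss_fun (k.+1%:R * (Num.sqrt (2 * (1 - eps) * n%:R))^-1) <= birthday_prod n k.+1.
Proof.
move=> e0 e1 n_gt0 kn.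
have n0 : 0 < n%:R :> R by rewrite ltr0n.
have e1' : 0 < 1 - eps by rewrite subr_gt0.
have N0 : 0 <= 2 * (1 - eps) * n%:R by rewrite !mulr_ge0// ltW.
suff H : expR (- (k%:R * k.+1%:R / (2 * (1 - eps) * n%:R))) <= birthday_prod n k.+1.
  rewrite gauss_fun_div_sqrt//; apply: le_trans H.
  rewrite ler_expR lerN2 ler_wpM2r ?invr_ge0//.
  by rewrite expr2 ler_wpM2r// ler_nat.
elim: k kn => [_|k IH kn].
  by rewrite /birthday_prod big_ord1 !mul0r subr0 oppr0 expR0.
rewrite /birthday_prod big_ord_recr/=.
have -> : - (k.+1%:R * k.+2%:R / (2 * (1 - eps) * n%:R)) =
    - (k%:R * k.+1%:R / (2 * (1 - eps) * n%:R)) - k.+1%:R / n%:R / (1 - eps) :> R.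
  by rewrite -[k.+2%:R]natr1 -[k.+1%:R]natr1; field; rewrite !lt0r_neq0.
have kn' : k.+1%:R <= eps * n%:R by apply: le_trans kn; rewrite ler_nat.
rewrite expRD ler_pM ?expR_ge0//; first exact: IH.
by rewrite expR_le_onem// ?divr_ge0// ler_pdivrMr.
Qed.

(** The target becomes the full Gauss integral divided by the step [1 / sqrt (2 n)]. *)
Lemma sqrt_pi_half n :
  Num.sqrt (pi * n%:R / 2) = Num.sqrt pi / 2 * Num.sqrt (2 * n%:R) :> R.
Proof.
rewrite half_sqrt_pi.
rewrite -sqrtrM ?divr_ge0 ?pi_ge0//; congr Num.sqrt; by field.
Qed.

Lemma birthday_sum_le n :
  \sum_(k < n) birthday_prod n k.+1 <= 1 + Num.sqrt (pi * n%:R / 2).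
Proof.
case: n => [|n]; first by rewrite big_ord0 addr_ge0// sqrtr_ge0.
set c := (Num.sqrt (2 * n.+1%:R))^-1 : R.
have c0 : 0 < c by rewrite invr_gt0 sqrtr_gt0 mulr_gt0.
apply: (@le_trans _ _ (\sum_(k < n.+1) gauss_fun (k%:R * c))).
  by apply: ler_sum => k _; exact: birthday_prod_le_gauss.
apply: le_trans (sum_gauss_fun_le _ c0) _.
rewrite lerD2l sqrt_pi_half -/c invrK ler_wpM2r ?sqrtr_ge0//.
exact: integral0_gauss_le.
Qed.

Lemma birthday_sum_ge eps n : 0 < eps -> eps < 1 -> (0 < n)%N ->
  (1 - eps) * Num.sqrt (2 * n%:R) * integral0_gauss (eps * Num.sqrt (n%:R / 2)) - 1
    <= \sum_(k < n) birthday_prod n k.+1.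
Proof.
move=> e0 e1 n_gt0.
have n0 : 0 < n%:R :> R by rewrite ltr0n.
have e1' : 0 < 1 - eps by rewrite subr_gt0.
have N0 : 0 < 2 * (1 - eps) * n%:R by rewrite !mulr_gt0.
(* Cutting at [m] keeps the ratios at most [eps], while [eps * n < m.+1] makes the integral reach
   far enough. The dropped terms are nonnegative. *)
pose m := Num.truncn (eps * n%:R).
have en0 : 0 <= eps * n%:R by rewrite mulr_ge0// ltW.
have /andP[men enm] := truncn_itv en0; rewrite -/m in men enm.
have mn : (m <= n)%N.
  by rewrite -(ler_nat R) (le_trans men)// ler_piMl// ltW.
set d := (Num.sqrt (2 * (1 - eps) * n%:R))^-1.
have d0 : 0 < d by rewrite invr_gt0 sqrtr_gt0.
apply: (@le_trans _ _ (\sum_(k < m) birthday_prod n k.+1)); last first.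
  rewrite (big_ord_widen n (fun k => birthday_prod n k.+1))// big_mkcond/=.
  by apply: ler_sum => k _; case: ifP => // _; exact: birthday_prod_ge0.
apply: (@le_trans _ _ (\sum_(k < m) gauss_fun (k.+1%:R * d))); last first.
  apply: ler_sum => k _; apply: gauss_le_birthday_prod => //.
  by rewrite (le_trans _ men)// ler_nat.
apply: le_trans (le_sum_gauss_fun _ d0); rewrite lerB//.
rewrite [leRHS]mulrC ler_pM ?integral0_gauss_ge0//.
- by rewrite mulr_ge0 ?sqrtr_ge0// ltW.
(* The factor [sqrt (1 - eps)] in the inverse of [d] is weakened to [1 - eps]. *)
- rewrite invrK -[X in X * _]ger0_norm ?(ltW e1')// -sqrtr_sqr -sqrtrM ?sqr_ge0//.
  rewrite ler_wsqrtr// mulrCA mulrA ler_wpM2r ?(ltW n0)// ler_wpM2l//.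
  by rewrite expr2 ler_piMl ?(ltW e1')// gerBl ltW.
apply: integral0_gauss_nondecreasing.
  by rewrite mulr_ge0 ?sqrtr_ge0// ltW.
apply: (@le_trans _ _ (eps * n%:R * d)); last by rewrite ler_wpM2r// ltW.
rewrite -mulrA ler_wpM2l ?(ltW e0)//.
rewrite /d -sqrtrV ?(ltW N0)// -[X in _ <= X * _]ger0_norm ?(ltW n0)// -sqrtr_sqr.
rewrite -sqrtrM ?sqr_ge0// ler_wsqrtr//.
rewrite expr2 -mulrA ler_wpM2l ?(ltW n0)//.
rewrite ler_pdivlMr// (_ : 2^-1 * _ = (1 - eps) * n%:R); last by field.
by rewrite ler_piMl ?(ltW n0)// gerBl ltW.
Qed.

Lemma birthday_sum_equiv :
  (fun n : nat => \sum_(k < n) birthday_prod n k.+1 : R^o) ~_\oo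
  (fun n : nat => Num.sqrt (pi * n%:R / 2) : R^o).
Proof.
apply/eqaddoP => e e0 /=.
(* The lower bound loses [eps * S] three times: twice through the square of [1 - eps] and once
   through the constant 1. The bound [1 / 2] ensures [eps < 1]. *)
pose eps : R := Num.min (e / 3) (1 / 2).
have eps0 : 0 < eps by rewrite lt_min !divr_gt0.
have eps1 : eps < 1 by rewrite gt_min; apply/orP; right; lra.
have epse : eps * 3 <= e by rewrite -ler_pdivlMr// ge_min lexx.
have pi2 : 0 < pi / 2 :> R by rewrite divr_gt0// pi_gt0.
have sqrt_pi_gt0 : 0 < Num.sqrt pi / 2 :> R by rewrite divr_gt0// sqrtr_gt0 pi_gt0.
have sqrty (a : R) : 0 < a -> Num.sqrt (a * n%:R) @[n --> \oo] --> +oo.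
  move=> a0; apply/cvgryPge => A.
  near=> n.
  have [A0|A0] := leP A 0; first by rewrite (le_trans A0)// sqrtr_ge0.
  rewrite -(ger0_norm (ltW A0)) -sqrtr_sqr ler_wsqrtr// mulrC -ler_pdivrMr//.
  by near: n; exact: nbhs_infty_ger.
have Gy : integral0_gauss (eps * Num.sqrt (n%:R / 2)) @[n --> \oo] -->
    (Num.sqrt pi / 2 : R).
  apply: cvg_comp cvg_integral0_gauss.
  have sE (n : nat) : eps * Num.sqrt (n%:R / 2) = Num.sqrt (eps ^+ 2 / 2 * n%:R).
    by rewrite -mulrA [RHS]sqrtrM ?sqr_ge0// sqrtr_sqr gtr0_norm// [_^-1 * _]mulrC.
  by under eq_fun do rewrite sE; apply: sqrty; rewrite divr_gt0// exprn_gt0.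
near=> n.
rewrite -[(_ - _) n]/(\sum_(k < n) birthday_prod n k.+1 - Num.sqrt (pi * n%:R / 2) : R).
set S := Num.sqrt (pi * n%:R / 2); set Q := \sum_(k < n) _.
have n_gt0 : (0 < n)%N by near: n; exact: nbhs_infty_gt.
have S0 : 0 <= S by exact: sqrtr_ge0.
(* For large [n] the additive constants 1 are absorbed into [eps * S]. *)
have S1 : eps^-1 <= S.
  rewrite /S mulrAC; near: n.
  have /cvgryPge := sqrty _ pi2; exact.
have eS : 1 <= eps * S by rewrite mulrC -ler_pdivrMr// div1r.
have G : Num.sqrt pi / 2 * (1 - eps) <= integral0_gauss (eps * Num.sqrt (n%:R / 2)).
  near: n; apply: (cvgr_ge _ Gy); by rewrite gtr_pMr// gtrBl.
have QU : Q <= 1 + S by exact: birthday_sum_le.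
have QL : (1 - eps) * (1 - eps) * S - 1 <= Q.
  apply: le_trans (birthday_sum_ge eps0 eps1 n_gt0); rewrite lerB//.
  rewrite /S sqrt_pi_half.
  have -> : (1 - eps) * (1 - eps) * (Num.sqrt pi / 2 * Num.sqrt (2 * n%:R)) =
    (1 - eps) * Num.sqrt (2 * n%:R) * (Num.sqrt pi / 2 * (1 - eps)) by ring.
  by rewrite ler_wpM2l// mulr_ge0 ?sqrtr_ge0// subr_ge0 ltW.
rewrite [X in _ <= _ * X]ger0_norm//.
have eS3 : eps * 3 * S <= e * S by rewrite ler_wpM2r.
have eeS : 0 <= eps * eps * S by rewrite !mulr_ge0// ltW.
rewrite ler_norml; apply/andP; split; nra.
Unshelve. all: by end_near. Qed.

End BirthdaySum.

Theorem mainTheorem4 (R : realType) (V : nat -> finType)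
    (cardV : forall n : nat, #|V n| = n) :
  (fun n : nat => expected_graph_min R (V n) : R^o) ~_\oo
  (fun n : nat => Num.sqrt (pi * n%:R / 2) : R^o).
Proof.
(* The two sequences agree at every [n]; at 0 both sums are empty. *)
have -> : (fun n : nat => expected_graph_min R (V n) : R^o) =
    (fun n : nat => \sum_(k < n) birthday_prod n k.+1 : R^o).
  apply/funext => n; rewrite expected_graph_minE cardV.
  by apply: eq_bigr => k _; rewrite birthday_prodE// (leq_ltn_trans _ (ltn_ord k)).
exact: birthday_sum_equiv.
Qed.
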